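(* Let $r\ge 2$ be an integer and let $G$ be a $K_{r+1}$-free finite simple graph. Define $$\kappa_r(G):=\max\{\nu_{K_r}(G[V(M)]-M): M \text{ is a matching in } G\},$$ where $\nu_{K_r}(F)$ denotes the maximum number of pairwise vertex-disjoint copies of $K_r$ in a graph $F$. Then $$\tau_{K_{r+1}}(G)=1 \iff \kappa_r(G)\ge 2.$$
   Context: All graphs are finite and simple. A matching is a set of pairwise vertex-disjoint edges; $V(M)$ denotes the set of endpoints of the edges of $M$; $G[V(M)]-M$ is the subgraph induced by $V(M)$ with the edges of $M$ deleted. Degree-preserving Builder--Chooser game started from a graph $G_0$: it is played in rounds $t=1,2,\dots$. In round $t$ the current graph is $G_{t-1}=(V,E)$. (i) Builder chooses a matching $M\subseteq E$ and forms the intermediate graph $G^+$ by deleting the edges of $M$, adding a new vertex $w$, and joining $w$ to every vertex of $V(M)$ (a DPG step). (ii) Builder chooses a partition of $E(G^+)$ into two disjoint sets $E^{(0)}\sqcup E^{(1)}$. (iii) Chooser selects $i\in\{0,1\}$, and $G_t:=(V(G^+),E^{(i)})$. For graphs $H$ and $G_0$, the forcing time $\tau_H(G_0)$ is the least $T\ge 0$ such that Builder has a strategy in the game started from $G_0$ guaranteeing that $G_t$ contains $H$ as a (not necessarily induced) subgraph for some $0\le t\le T$; $\tau_H(G_0)=\infty$ if there is no such $T$, i.e. if Chooser can avoid $H$ forever. *)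

(* Defs.v *)
From HB Require Import structures.
From mathcomp Require Import all_boot.
From mathcomp Require Import boolp.

Set Implicit Arguments.
Unset Strict Implicit.
Unset Printing Implicit Defensive.

Record sgraph := SGraph {
  vertex :> finType;
  edges : {set {set vertex}};
  edges_card2 : [forall e in edges, #|e| == 2] }.

Lemma complete_card2 n : [forall e in [set e : {set 'I_n} | #|e| == 2], #|e| == 2].
Proof. by apply/forall_inP => e; rewrite inE. Qed.

Definition complete (n : nat) : sgraph := SGraph (complete_card2 n).

Section Subgraphs.
Variables H G : sgraph.

Definition embedding (f : {ffun H -> G}) : bool :=
  injectiveb f && [forall e in edges H, f @: e \in edges G].

(* Not necessarily induced. *)
Definition contains : bool := [exists f : {ffun H -> G}, embedding f].

Definition copy_on (S : {set G}) : bool :=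
  [exists f : {ffun H -> G}, embedding f && (f @: [set: H] == S)].

(* A family of pairwise vertex-disjoint copies of H is represented by the
   family of their vertex sets; this loses nothing for counting as soon as H
   has at least one vertex. *)
Definition packing_number : nat :=
  \max_(P : {set {set G}} | trivIset P && [forall S in P, copy_on S]) #|P|.

End Subgraphs.

Section Matchings.
Variable G : sgraph.

Definition is_matching (M : {set {set G}}) : bool :=
  (M \subset edges G) && trivIset M.

Lemma del_edges_card2 (M : {set {set G}}) :
  [forall e in edges G :\: M, #|e| == 2].
Proof.
by apply/forall_inP => e /setDP[eG _]; apply: (forall_inP (edges_card2 G)).
Qed.

Definition del_edges (M : {set {set G}}) : sgraph := SGraph (del_edges_card2 M).

Lemma induced_card2 (U : {set G}) :
  [forall e in [set e : {set {x : G | x \in U}} | val @: e \in edges G],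
     #|e| == 2].
Proof.
apply/forall_inP => e; rewrite inE => eG.
by rewrite -(card_imset _ val_inj) (forall_inP (edges_card2 G)).
Qed.

Definition induced (U : {set G}) : sgraph := SGraph (induced_card2 U).

End Matchings.

(* [cover M] is the vertex set V(M).  Deleting M first and then inducing on
   V(M) gives the same graph as G[V(M)] - M, since M lies inside V(M). *)
Definition matched_part (G : sgraph) (M : {set {set G}}) : sgraph :=
  @induced (del_edges M) (cover M).

Definition kappa (r : nat) (G : sgraph) : nat :=
  \max_(M : {set {set G}} | is_matching M)
     packing_number (complete r) (matched_part M).

Section Moves.
Variable G : sgraph.

(* [None] is the new vertex w. *)
Definition dpg_edges (M : {set {set G}}) : {set {set option G}} :=
  [set Some @: e | e : {set G} in edges G :\: M]
    :|: [set [set None; Some x] | x in cover M].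

Lemma dpg_card2 (M : {set {set G}}) : [forall e in dpg_edges M, #|e| == 2].
Proof.
apply/forall_inP => e /setUP[] /imsetP[a aP ->]; last by rewrite cards2.
rewrite card_imset; last exact: Some_inj.
exact: (forall_inP (del_edges_card2 M)).
Qed.

Definition dpg_step (M : {set {set G}}) : sgraph := SGraph (dpg_card2 M).

Record move := Move {
  move_matching : {set {set G}};
  move_matchingP : is_matching move_matching;
  move_part : bool -> {set {set dpg_step move_matching}};
  move_part_cover :
    move_part false :|: move_part true = edges (dpg_step move_matching);
  move_part_disjoint : [disjoint move_part false & move_part true] }.

Lemma next_card2 (m : move) (i : bool) : [forall e in move_part m i, #|e| == 2].
Proof.
apply/forall_inP => e ei.
apply: (forall_inP (edges_card2 (dpg_step (move_matching m)))).
by rewrite -move_part_cover inE; case: i ei => ->; rewrite ?orbT.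
Qed.

Definition next (m : move) (i : bool) : sgraph := SGraph (next_card2 m i).

End Moves.

(* Builder moves as a function of Chooser's past choices and of the current
   graph; for a fixed strategy and starting graph these choices determine the
   whole history of the play. *)
Definition strategy : Type := seq bool -> forall G : sgraph, move G.

(* G_t, when Chooser's selection in round t + 1 is c t. *)
Fixpoint play (s : strategy) (G0 : sgraph) (c : nat -> bool) (t : nat) : sgraph :=
  if t is t'.+1 then next (s (mkseq c t') (play s G0 c t')) (c t') else G0.

Definition forces_within (H G0 : sgraph) (T : nat) : Prop :=
  exists s : strategy, forall c : nat -> bool,
    exists2 t, t <= T & contains H (play s G0 c t).

(* [None] stands for infinity. *)
Definition forcing_time (H G0 : sgraph) : option nat :=
  if pselect (exists T, `[< forces_within H G0 T >]) is left ex
  then Some (ex_minn ex) else None.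

(* Main.v *)
Require Import Defs.
From mathcomp Require Import all_boot.
From mathcomp Require Import boolp.

(** The only one-round threat is a copy of [K_{r+1}] through the new vertex [w],
    since the rest of the new graph is a subgraph of the [K_{r+1}]-free graph
    [G].  Such copies are exactly the cones over copies of [K_r] in
    [G[V(M)] - M].  Builder wins in one round iff both classes of the edge
    partition contain such a cone, and two cones over [K_r]'s are edge-disjoint
    iff the two [K_r]'s are vertex-disjoint. *)

Set Implicit Arguments.
Unset Strict Implicit.
Unset Printing Implicit Defensive.

(** Taken over a bare edge set, so that the same vertex set can be tested in all of [dpg_edges M]
    and in a single class of Builder's partition. *)
Definition clique (T : finType) (E : {set {set T}}) (S : {set T}) : Prop :=
  {in S &, forall x y, x != y -> [set x; y] \in E}.

Lemma sub_clique (T : finType) (E E' : {set {set T}}) (S : {set T}) :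
  E \subset E' -> clique E S -> clique E' S.
Proof.
by move=> /subsetP sEE' cS x y xS yS xy; apply: sEE'; apply: cS.
Qed.

(** All pairs are edges of a complete graph, so any enumeration of a clique is an embedding. Copies
    can then be handled as vertex sets alone. *)
Lemma copy_on_completeP n (G : sgraph) (S : {set G}) :
  reflect (#|S| = n /\ clique (edges G) S) (copy_on (complete n) S).
Proof.
apply: (iffP existsP) => [[f /andP[/andP[/injectiveP f_inj fE]] /eqP <-]|].
  split=> [|_ _ /imsetP[a _ ->] /imsetP[b _ ->] ab].
    by rewrite card_imset // cardsT card_ord.
  have := forall_inP fE [set a; b].
  rewrite imsetU !imset_set1; apply; rewrite inE cards2.
  by rewrite (contraNneq _ ab) // => ->.
case=> Sn; move: Sn => <- {n} cS.
exists [ffun i : 'I_#|S| => enum_val i]; apply/andP; split.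
  apply/andP; split.
    by apply/injectiveP => i j; rewrite !ffunE; apply: enum_val_inj.
  apply/forall_inP => e; rewrite inE => /cards2P[i [j [ij ->]]].
  rewrite imsetU !imset_set1 !ffunE; apply: cS; try exact: enum_valP.
  by rewrite (inj_eq enum_val_inj).
apply/eqP/setP => x; apply/imsetP/idP => [[i _ ->]|xS].
  by rewrite ffunE; apply: enum_valP.
by exists (enum_rank_in xS x); rewrite ?inE // ffunE enum_rankK_in.
Qed.

Lemma contains_completeP n (G : sgraph) :
  reflect (exists2 S : {set G}, #|S| = n & clique (edges G) S)
          (contains (complete n) G).
Proof.
apply: (iffP existsP) => [[f fE]|[S Sn cS]].
  have /copy_on_completeP[fn cf] : copy_on (complete n) (f @: [set: complete n]).
    by apply/existsP; exists f; rewrite fE eqxx.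
  by exists (f @: [set: complete n]).
have /existsP[f /andP[fE _]] : copy_on (complete n) S by apply/copy_on_completeP.
by exists f.
Qed.

Lemma packing_number_ge2 n (G : sgraph) : 0 < n ->
  2 <= packing_number (complete n) G <->
  exists S1 S2 : {set G},
    [/\ copy_on (complete n) S1, copy_on (complete n) S2 & [disjoint S1 & S2]].
Proof.
move=> n_gt0; split=> [|[S1 [S2 [c1 c2 dS]]]].
  rewrite ltnNge => geP.
  have [[P] | noP] := pickP [pred P : {set {set G}} |
    [&& trivIset P, [forall S in P, copy_on (complete n) S] & 1 < #|P|]].
    case/and3P=> tP /forall_inP cP /card_gt1P[S1 [S2 [S1P S2P S12]]].
    by exists S1, S2; rewrite !cP // (trivIsetP tP).
  case/negP: geP; apply/bigmax_leqP => P /andP[tP cP].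
  by have /= := noP P; rewrite tP cP /= => /negbT; rewrite -leqNgt.
(* Disjoint sets can coincide only when empty, which [0 < n] rules out. *)
have S12 : S1 != S2.
  apply: contraTneq dS => <-; rewrite -setI_eq0 setIid -card_gt0.
  by have /copy_on_completeP[->] := c1.
have <- : #|[set S1; S2]| = 2 by rewrite cards2 S12.
apply: (leq_bigmax_cond (P := fun P : {set {set G}} =>
  trivIset P && [forall S in P, copy_on (complete n) S])).
apply/andP; split; last by apply/forall_inP=> S /set2P[] ->.
apply/trivIsetP => A B /set2P[] -> /set2P[] -> //; rewrite ?eqxx //.
by rewrite disjoint_sym.
Qed.

Lemma kappa_ge2 r (G : sgraph) : 0 < r ->
  2 <= kappa r G <->
  exists2 M : {set {set G}}, is_matching M &
  exists S1 S2 : {set matched_part M},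
    [/\ copy_on (complete r) S1, copy_on (complete r) S2 & [disjoint S1 & S2]].
Proof.
move=> r_gt0; split=> [|[M mM /packing_number_ge2 packM]].
  rewrite ltnNge => geM.
  have [M /andP[mM /packing_number_ge2 packM] | noM] := pickP
    [pred M : {set {set G}} | is_matching M &&
      (1 < packing_number (complete r) (matched_part M))].
    by exists M => //; apply: packM.
  case/negP: geM; apply/bigmax_leqP => M mM.
  by have /= := noM M; rewrite mM /= => /negbT; rewrite -leqNgt.
apply: leq_trans (packM r_gt0) _.
exact: (@leq_bigmax_cond _ (@is_matching G)
  (fun M => packing_number (complete r) (matched_part M))).
Qed.

Section Cone.
Variables (G : sgraph) (M : {set {set G}}).

Lemma mem_dpg_edges_old (x y : G) :
  ([set Some x; Some y] \in dpg_edges M) = ([set x; y] \in edges G :\: M).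
Proof.
rewrite -!imset_set1 -imsetU in_setU mem_imset; last exact: imset_inj Some_inj.
(* [None] lies in every spoke at the new vertex and in no image under [Some], so an old edge is
   never a spoke. *)
rewrite orbC; case: imsetP => //= -[z _ /setP/(_ None)].
by rewrite !inE /= imsetU !imset_set1 !inE.
Qed.

Lemma mem_dpg_edges_new (x : G) :
  ([set None; Some x] \in dpg_edges M) = (x \in cover M).
Proof.
rewrite in_setU; case: imsetP => [[e _ /setP/(_ None)]|_] /=.
  by rewrite !inE /= => /esym/imsetP[].
apply/imsetP/idP => [[y yM /setP/(_ (Some x))]|xM]; last by exists x.
by rewrite !inE /= eqxx => /esym/eqP[->].
Qed.

Lemma mem_matched_part_edges (u v : matched_part M) :
  ([set u; v] \in edges (matched_part M)) =
  ([set val u; val v] \in edges G :\: M).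
Proof. by rewrite inE imsetU !imset_set1. Qed.

Definition cone (S : {set matched_part M}) : {set option G} :=
  None |: [set Some (val u) | u in S].

Lemma mem_cone S (u : matched_part M) : (Some (val u) \in cone S) = (u \in S).
Proof. by rewrite !inE /= (mem_imset _ _ (inj_comp Some_inj val_inj)). Qed.

Lemma card_cone S : #|cone S| = #|S|.+1.
Proof.
rewrite cardsU1 card_imset; last exact: (inj_comp Some_inj val_inj).
by rewrite -add1n; case: imsetP => // -[].
Qed.

(** The new vertex is joined to all of V(M), and the edges of [matched_part M] avoid M, hence
    survive the step. *)
Lemma clique_cone S :
  clique (edges (matched_part M)) S -> clique (dpg_edges M) (cone S).
Proof.
move=> cS x y /setU1P[->|/imsetP[u uS ->]] /setU1P[->|/imsetP[v vS ->]].
- by rewrite eqxx.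
- by rewrite mem_dpg_edges_new (valP v).
- by rewrite setUC mem_dpg_edges_new (valP u).
- by move=> uv; rewrite mem_dpg_edges_old -mem_matched_part_edges cS.
Qed.

(** A clique missing the new vertex would pull back along [Some] to a clique of the same size in
    G. *)
Lemma clique_dpg_new n (T : {set option G}) :
  ~~ contains (complete n) G -> #|T| = n -> clique (dpg_edges M) T -> None \in T.
Proof.
move=> nG Tn cT; apply: contraNT nG => TN; apply/contains_completeP.
have TE : T = Some @: (Some @^-1: T).
  apply/setP=> -[x|]; first by rewrite mem_imset ?inE //; apply: Some_inj.
  by rewrite (negPf TN); apply/esym/imsetP=> -[].
exists (Some @^-1: T); first by rewrite -Tn [in RHS]TE card_imset //; apply: Some_inj.
move=> x y /[!inE] xT yT xy.
have /setDP[] // : [set x; y] \in edges G :\: M.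
by rewrite -mem_dpg_edges_old cT.
Qed.

Lemma clique_dpg_cone (T : {set option G}) :
  None \in T -> clique (dpg_edges M) T ->
  exists2 S, T = cone S & clique (edges (matched_part M)) S.
Proof.
move=> TN cT; exists [set u : matched_part M | Some (val u) \in T].
  apply/setP=> -[x|]; last by rewrite TN !inE.
  apply/idP/idP => [xT|/setU1P[//|/imsetP[u /[!inE] uT -> //]]].
  (* The clique contains the spoke from [None] to [Some x], and spokes end only in V(M). *)
  have xM : x \in cover M by rewrite -mem_dpg_edges_new cT.
  have -> : x = val (Sub x xM : matched_part M) by rewrite SubK.
  by rewrite mem_cone inE SubK.
move=> u v; rewrite [u \in _]inE [v \in _]inE => uT vT uv.
by rewrite mem_matched_part_edges -mem_dpg_edges_old cT.
Qed.

End Cone.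

Definition winning (H G : sgraph) (m : move G) : Prop :=
  forall i, contains H (Defs.next m i).

Section SplitMove.
Variables (G : sgraph) (M : {set {set G}}) (mM : is_matching M).
Variable (F : {set {set option G}}).

(** Only the trace of F on the edges matters, so any F yields a legal partition and class [false]
    can be prescribed by a convenient set of pairs. *)
Definition split_part (i : bool) : {set {set option G}} :=
  if i then dpg_edges M :\: F else dpg_edges M :&: F.

Lemma split_cover :
  split_part false :|: split_part true = edges (dpg_step M).
Proof. exact: setID. Qed.

Lemma split_disjoint : [disjoint split_part false & split_part true].
Proof.
rewrite -setI_eq0; apply/eqP/setP=> e; rewrite !inE.
by case: (e \in F); rewrite ?andbF.
Qed.

Definition split_move : move G :=
  @Move G M mM split_part split_cover split_disjoint.

End SplitMove.

(** Gives Builder a legal default move in every graph, as a strategy must be total. *)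
Lemma is_matching0 (G : sgraph) : is_matching (set0 : {set {set G}}).
Proof. by rewrite /is_matching sub0set /=; apply/trivIsetP => A B; rewrite inE. Qed.

Lemma forces_within0 (H G : sgraph) : forces_within H G 0 -> contains H G.
Proof. by case=> s /(_ (fun=> true)) [t]; rewrite leqn0 => /eqP->. Qed.

Lemma forces_within1 (H G : sgraph) : ~~ contains H G ->
  forces_within H G 1 <-> exists m : move G, winning H m.
Proof.
move=> nG; split=> [[s sH]|[m wm]].
  (* A Chooser who always plays [i] tests that reply to the opening move; success at time 0 is
     excluded by [nG]. *)
  exists (s [::] G) => i; case: (sH (fun=> i)) => -[_ HG|[|//]] //.
  by rewrite HG in nG.
(* A move cannot be transported along an equation of graphs, so Builder plays,
   on every graph, some winning move whenever there is one. *)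
pose s (_ : seq bool) (K : sgraph) : move K :=
  if pselect (exists m : move K, winning H m) is left ex then projT1 (cid ex)
  else split_move (is_matching0 K) set0.
exists s => c; exists 1 => //=; rewrite /s.
case: pselect => [ex|[]]; last by exists m.
exact: (projT2 (cid ex)).
Qed.

Lemma forcing_time_eq1 (H G : sgraph) : ~~ contains H G ->
  forcing_time H G = Some 1 <-> exists m : move G, winning H m.
Proof.
move=> nG; rewrite -(forces_within1 nG) /forcing_time.
case: pselect => [ex|nex]; last by split=> // f1; case: nex; exists 1; apply/asboolP.
case: ex_minnP => t /asboolP ft tmin; split=> [[<-] //|f1].
(* Minimality bounds the time by 1, and time 0 would mean that G already contains H. *)
have := tmin 1; rewrite asboolT // => /(_ isT).
case: t ft {tmin} => [/forces_within0|[|//]] // HG.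
by rewrite HG in nG.
Qed.

Lemma winning_moveP r (G : sgraph) : ~~ contains (complete r.+1) G ->
  (exists m : move G, winning (complete r.+1) m) <->
  exists2 M : {set {set G}}, is_matching M &
  exists S1 S2 : {set matched_part M},
    [/\ copy_on (complete r) S1, copy_on (complete r) S2 & [disjoint S1 & S2]].
Proof.
move=> nG; split=> [[m wm]|[M mM [S1 [S2 [c1 c2 dS]]]]].
  exists (move_matching m); first exact: move_matchingP.
  (* The cone is a clique in class [i] itself, not just in the intermediate graph; this lets the
     disjointness of the classes act on the cones. *)
  have cones i : exists S : {set matched_part (move_matching m)},
      copy_on (complete r) S /\ clique (move_part m i) (cone S).
    have /contains_completeP[T Tr cT] := wm i.
    have sub : move_part m i \subset dpg_edges (move_matching m).
      rewrite -[dpg_edges _]/(edges (dpg_step _)) -move_part_cover.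
      by case: (i); rewrite ?subsetUl ?subsetUr.
    have cT' := sub_clique sub cT.
    have [S TS cS] := clique_dpg_cone (clique_dpg_new nG Tr cT') cT'.
    exists S; rewrite -TS; split=> //; apply/copy_on_completeP; split=> //.
    by apply/eqP; rewrite -eqSS -(card_cone S) -TS Tr.
  have [[S1 [c1 k1]] [S2 [c2 k2]]] := (cones false, cones true).
  exists S1, S2; split=> //; apply/pred0P => u /=.
  apply/negP => /andP[u1 u2].
  (* A common vertex [u] would put the spoke from [None] to [u] into both classes. *)
  have wu (S : {set matched_part (move_matching m)}) (i : bool) :
      clique (move_part m i) (cone S) -> u \in S ->
      [set None; Some (val u)] \in move_part m i.
    by move=> cS uS; apply: cS; rewrite ?mem_cone // setU11.
  have := disjointFr (move_part_disjoint m) (wu _ _ k1 u1).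
  by rewrite (wu _ _ k2 u2).
have /copy_on_completeP[r1 k1] := c1; have /copy_on_completeP[r2 k2] := c2.
(* Class [false] receives exactly the edges inside [cone S1], class [true] all others. *)
exists (split_move mM (powerset (cone S1))) => i; apply/contains_completeP.
case: i; [exists (cone S2) | exists (cone S1)]; rewrite ?card_cone ?r1 ?r2 //.
  move=> x y x2 y2 xy; apply/setDP; split; first exact: (clique_cone k2).
  rewrite inE subUset !sub1set; apply/negP => /andP[x1 y1].
  (* The two cones share only their apex, so no edge of the second has both ends in the first. *)
  have no_common z : z \in cone S1 -> z \in cone S2 -> z = None.
    case/setU1P=> [//|/imsetP[u u1 ->]]; rewrite mem_cone.
    by rewrite (disjointFr dS u1).
  by move: xy; rewrite (no_common x x1 x2) (no_common y y1 y2) eqxx.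
move=> x y x1 y1 xy; apply/setIP; split; first exact: (clique_cone k1).
by rewrite inE subUset !sub1set x1.
Qed.

Theorem theorem4p1 (r : nat) (G : sgraph) (hr : 2 <= r)
  (hG : ~~ contains (complete r.+1) G) :
  forcing_time (complete r.+1) G = Some 1 <-> 2 <= kappa r G.
Proof.
by rewrite (forcing_time_eq1 hG) (winning_moveP hG) (kappa_ge2 G (ltnW hr)).
Qed.
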